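(* (Effective de Moivre–Laplace central limit theorem.) Let $p$ be a computable real number with $0<p<1$, $q=1-p$, and let $\{X_n\}$ be a sequence of independent $\{0,1\}$-valued random variables on a probability space $(\Omega,\mathcal{B},\mathbb{P})$ with $\mathbb{P}(X_n=1)=p$ and $\mathbb{P}(X_n=0)=q$. Put $Y_m=\frac{X_1+\cdots+X_m-mp}{\sqrt{mpq}}$. Then the sequence of probability distributions of $Y_m$ converges effectively to the standard Gaussian distribution $N(0,1)$.
   Context: A probability distribution is a Borel probability measure $\mu$ on $\mathbb{R}$; $\mu(f)=\int f\,d\mu$. Computability of real functions is in the sense of Pour-El and Richards: $\{f_n\}$ is computable if (i) for every computable sequence of reals $\{x_j\}$, $\{f_n(x_j)\}$ is a computable double sequence, and (ii) there is a recursive $\alpha(n,L,k)$ with $|x-y|<2^{-\alpha(n,L,k)}$, $|x|,|y|\le L$ implying $|f_n(x)-f_n(y)|<2^{-k}$. $\{f_n\}$ is computable with compact support if it is computable and there is a recursive $L(n)$ with $f_n(x)=0$ for $|x|\ge L(n)$. A sequence of probability distributions $\{\mu_m\}$ converges effectively to $\mu$ if for every computable $\{f_n\}$ with compact support there is a recursive $\beta(n,k)$ with $|\mu_m(f_n)-\mu(f_n)|<2^{-k}$ whenever $m\ge\beta(n,k)$. *)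

(* Defs.v *)
From HB Require Import structures.
From mathcomp Require Import all_boot all_order all_algebra.
From mathcomp Require Import all_classical all_reals all_analysis.

Set Implicit Arguments.
Unset Strict Implicit.
Unset Printing Implicit Defensive.

Import Order.TTheory GRing.Theory Num.Theory.
Import numFieldNormedType.Exports.

Local Open Scope classical_set_scope.
Local Open Scope ring_scope.

(* Total recursive functions of n arguments, in Kleene's presentation: since
   minimization is only applied to regular functions (those for which a zero
   exists for all values of the parameters), no partial function is needed, and
   by the normal form theorem every total recursive function is obtained.
   Recursion and minimization act on the head of the tuple of arguments. *)
Inductive recursive : forall n : nat, (n.-tuple nat -> nat) -> Prop :=
| rec_zero : recursive (fun _ : 0.-tuple nat => 0%N)
| rec_succ : recursive (fun v : 1.-tuple nat => (thead v).+1)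
| rec_proj n (i : 'I_n) : recursive (fun v : n.-tuple nat => tnth v i)
| rec_comp m n (g : m.-tuple nat -> nat) (h : 'I_m -> n.-tuple nat -> nat) :
    recursive g -> (forall i, recursive (h i)) ->
    recursive (fun v : n.-tuple nat => g [tuple h i v | i < m])
| rec_prim n (g : n.-tuple nat -> nat) (h : n.+2.-tuple nat -> nat) :
    recursive g -> recursive h ->
    recursive (fun v : n.+1.-tuple nat =>
      nat_rect (fun _ => nat) (g [tuple of behead v])
        (fun k r => h [tuple of k :: r :: behead v]) (thead v))
| rec_min n (g : n.+1.-tuple nat -> nat) (f : n.-tuple nat -> nat) :
    recursive g ->
    (forall v : n.-tuple nat, g [tuple of f v :: v] = 0%N /\
       forall k, (k < f v)%N -> g [tuple of k :: v] <> 0%N) ->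
    recursive f.

Definition recursive1 (f : nat -> nat) :=
  recursive (fun v : 1.-tuple nat => f (nth 0%N v 0)).

Definition recursive2 (f : nat -> nat -> nat) :=
  recursive (fun v : 2.-tuple nat => f (nth 0%N v 0) (nth 0%N v 1)).

Definition recursive3 (f : nat -> nat -> nat -> nat) :=
  recursive (fun v : 3.-tuple nat =>
    f (nth 0%N v 0) (nth 0%N v 1) (nth 0%N v 2)).

(* Pour-El and Richards define computable rationals and reals for single
   sequences, double sequences, etc.; here d is the number of indices. *)
Definition computable_rats (d : nat) (r : d.-tuple nat -> rat) :=
  exists s a b : d.-tuple nat -> nat,
    [/\ recursive s, recursive a, recursive b &
        forall v, b v <> 0%N /\ r v = (-1) ^+ s v * (a v)%:R / (b v)%:R].

(* The approximating family r has one more index k (at the head of the tuple),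
   and r (k, v) tends to x v as k grows, effectively in k and v, with modulus
   of convergence e. *)
Definition computable_reals (R : realType) (d : nat) (x : d.-tuple nat -> R) :=
  exists r : d.+1.-tuple nat -> rat, computable_rats r /\
  exists e : d.+1.-tuple nat -> nat, recursive e /\
    forall (v : d.-tuple nat) (N k : nat), (e [tuple of N :: v] <= k)%N ->
      `|ratr (r [tuple of k :: v]) - x v| <= 2 ^- N.

Definition computable_real (R : realType) (x : R) :=
  computable_reals (fun _ : 0.-tuple nat => x).

Definition computable_seq (R : realType) (x : nat -> R) :=
  computable_reals (fun v : 1.-tuple nat => x (nth 0%N v 0)).

Definition computable_seq2 (R : realType) (x : nat -> nat -> R) :=
  computable_reals (fun v : 2.-tuple nat => x (nth 0%N v 0) (nth 0%N v 1)).

Definition computable_funs (R : realType) (f : nat -> R -> R) :=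
  (forall x : nat -> R, computable_seq x ->
     computable_seq2 (fun n j => f n (x j))) /\
  (exists alpha : nat -> nat -> nat -> nat, recursive3 alpha /\
     forall (n L k : nat) (x y : R), `|x| <= L%:R -> `|y| <= L%:R ->
       `|x - y| < 2 ^- alpha n L k -> `|f n x - f n y| < 2 ^- k).

Definition computable_funs_compact_support (R : realType)
    (f : nat -> R -> R) :=
  computable_funs f /\
  exists L : nat -> nat, recursive1 L /\
    forall (n : nat) (x : R), (L n)%:R <= `|x| -> f n x = 0.

(* measurableTypeR R is R with its Borel sigma-algebra; the library's normal_prob
   is a probability on this type, which is not interchangeable with the default
   measurable structure on R (same sets, but a different display). *)
Definition converges_effectively (R : realType)
    (mu : nat -> probability (measurableTypeR R) R)
    (nu : probability (measurableTypeR R) R) :=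
  forall f : nat -> R -> R, computable_funs_compact_support f ->
    exists beta : nat -> nat -> nat, recursive2 beta /\
      forall n k m : nat, (beta n k <= m)%N ->
        `|\int[mu m]_x f n x - \int[nu]_x f n x| < 2 ^- k.

Definition independent_RVs d (T : measurableType d) (R : realType)
    (P : probability T R) (X : nat -> {RV P >-> R}) :=
  forall (s : seq nat) (B : nat -> set R), uniq s ->
    (forall i, measurable (B i)) ->
    (P (\big[setI/setT]_(i <- s) (X i @^-1` B i)) =
     \prod_(i <- s) P (X i @^-1` B i))%E.

(* Main.v *)
Require Import Defs.
From mathcomp Require Import all_boot all_order all_algebra.
From mathcomp Require Import all_classical all_reals all_analysis.
From mathcomp Require Import measurable_realfun ring lra zify.

Import Order.TTheory GRing.Theory Num.Theory.
Import numFieldNormedType.Exports.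

Local Open Scope classical_set_scope.
Local Open Scope ring_scope.

Set Implicit Arguments.
Unset Strict Implicit.
Unset Printing Implicit Defensive.

(* Stein's method. For bounded continuous h with Gaussian mean c, the function
   g x = (\int_{-oo}^x (h - c) phi) / phi x solves g' = x g + (h - c), and the
   Gaussian tail bound \int_a^oo phi <= phi a / a makes g, x g and g' bounded by
   multiples of a bound B of |h - c|.  If S is binomial with parameters m.+1, p and
   W = (S - m.+1 p) / s with s ^ 2 = m.+1 p q, then
     E[(S - m.+1 p) psi(S)] = m.+1 p q E[psi(S' + 1) - psi(S')]
   with S' binomial with parameters m, p; hence E[h(W)] - c = E[g'(W) - W g(W)] is
   an average of increments of g' over distances at most s^-1, so that it is at most
   2 w + K B / s, where w bounds the increments of h over such distances and K only
   depends on p.  For h = f_n, both w and B are controlled by the given modulus of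
   continuity and the given bound of the support, so a recursive beta can be written
   down, the constant depending on p being hidden in one fixed natural number. *)

(** * Closure properties of recursive functions *)

Lemma recursive_ext n (f g : n.-tuple nat -> nat) : f =1 g -> recursive f -> recursive g.
Proof. by move=> /funext ->. Qed.

Lemma recursive_tnth n (f : n.-tuple nat -> nat) (i : 'I_n) :
  (forall v, f v = nth 0%N v i) -> recursive f.
Proof.
move=> fE; apply: (recursive_ext (f := fun v : n.-tuple nat => tnth v i)); last first.
  exact: rec_proj.
by move=> v; rewrite fE (tnth_nth 0%N).
Qed.

Lemma recursive_comp1 n (g : nat -> nat) (h : n.-tuple nat -> nat) :
  recursive1 g -> recursive h -> recursive (fun v => g (h v)).
Proof.
move=> rg rh.
apply: (@recursive_ext _ _ _ _ (rec_comp (h := fun=> h) rg (fun=> rh))) => v.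
by rewrite (nth_mktuple _ _ ord0).
Qed.

Lemma recursive_comp2 n (g : nat -> nat -> nat) (h0 h1 : n.-tuple nat -> nat) :
  recursive2 g -> recursive h0 -> recursive h1 ->
  recursive (fun v => g (h0 v) (h1 v)).
Proof.
move=> rg r0 r1.
have rh : forall i : 'I_2, recursive (nth h0 [:: h0; h1] i).
  by case=> -[|[|]].
apply: (@recursive_ext _ _ _ _ (rec_comp rg rh)) => v.
by rewrite (nth_mktuple _ _ ord0) (nth_mktuple _ _ (@Ordinal 2 1 isT)).
Qed.

Lemma recursive_comp3 n (g : nat -> nat -> nat -> nat)
    (h0 h1 h2 : n.-tuple nat -> nat) :
  recursive3 g -> recursive h0 -> recursive h1 -> recursive h2 ->
  recursive (fun v => g (h0 v) (h1 v) (h2 v)).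
Proof.
move=> rg r0 r1 r2.
have rh : forall i : 'I_3, recursive (nth h0 [:: h0; h1; h2] i).
  by case=> -[|[|[|]]].
apply: (@recursive_ext _ _ _ _ (rec_comp rg rh)) => v.
by rewrite (nth_mktuple _ _ ord0) (nth_mktuple _ _ (@Ordinal 3 1 isT))
  (nth_mktuple _ _ (@Ordinal 3 2 isT)).
Qed.

Lemma recursive1_S : recursive1 S.
Proof.
by apply: (@recursive_ext _ _ _ _ rec_succ) => v; rewrite /thead (tnth_nth 0%N).
Qed.

Lemma recursive_const n c : recursive (fun _ : n.-tuple nat => c).
Proof.
elim: c => [|c IH].
  (* [rec_zero] has arity 0; composing it with the empty family gives the zero function of arity
     [n]. *)
  have rh : forall i : 'I_0, recursive (fun _ : n.-tuple nat => (i : nat)) by case.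
  exact: (@recursive_ext _ _ _ _ (rec_comp rec_zero rh)).
exact: recursive_comp1 recursive1_S IH.
Qed.

Lemma recursive2_addn : recursive2 addn.
Proof.
have rg : recursive (fun v : 1.-tuple nat => nth 0%N v 0).
  exact: (@recursive_tnth _ _ ord0).
(* The step function of [rec_prim] receives counter, previous value and parameters in this order, so
   entry 1 is the previous value. *)
have rh : recursive (fun v : 3.-tuple nat => (nth 0%N v 1).+1).
  by apply: (recursive_comp1 recursive1_S);
     exact: (@recursive_tnth _ _ (@Ordinal 3 1 isT)).
apply: (@recursive_ext _ _ _ _ (rec_prim rg rh)) => v.
case/tupleP: v => a v; case/tupleP: v => b v.
by rewrite theadE /=; elim: a => //= a ->.
Qed.

Lemma recursive1_exp2n : recursive1 (expn 2).
Proof.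
have rh : recursive (fun v : 2.-tuple nat => nth 0%N v 1 + nth 0%N v 1)%N.
  by apply: (recursive_comp2 recursive2_addn);
     exact: (@recursive_tnth _ _ (@Ordinal 2 1 isT)).
apply: (@recursive_ext _ _ _ _ (rec_prim (recursive_const 0 1) rh)) => v.
case/tupleP: v => a v.
by rewrite theadE /=; elim: a => //= a ->; rewrite expnS mul2n addnn.
Qed.

(** * Binomial expectations and their Stein identity *)

(* The expectation of phi(S) for S binomial with parameters m and p, by conditioning
   on one trial. *)
Fixpoint binexp (R : pzRingType) (p : R) (m : nat) (phi : R -> R) : R :=
  if m is m'.+1 then
    p * binexp p m' (fun x => phi (x + 1)) + (1 - p) * binexp p m' phi
  else phi 0.

Lemma eq_binexp (R : pzRingType) (p : R) m (phi psi : R -> R) :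
  phi =1 psi -> binexp p m phi = binexp p m psi.
Proof. by move=> /funext ->. Qed.

Lemma binexpB (R : comPzRingType) (p : R) m (phi psi : R -> R) :
  binexp p m (fun x => phi x - psi x) = binexp p m phi - binexp p m psi.
Proof. by elim: m phi psi => //= m IH phi psi; rewrite !IH; ring. Qed.

Lemma binexpZ (R : comPzRingType) (p a : R) m (phi : R -> R) :
  binexp p m (fun x => a * phi x) = a * binexp p m phi.
Proof. by elim: m phi => //= m IH phi; rewrite !IH; ring. Qed.

Lemma binexp_cst (R : comPzRingType) (p a : R) m : binexp p m (fun=> a) = a.
Proof. by elim: m => //= m ->; ring. Qed.

Lemma binexpD (R : comPzRingType) (p : R) m (phi psi : R -> R) :
  binexp p m (fun x => phi x + psi x) = binexp p m phi + binexp p m psi.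
Proof. by elim: m phi psi => //= m IH phi psi; rewrite !IH; ring. Qed.

(** Induction on [m] by conditioning on one trial. Re-centring from [m.+2] to [m.+1] trials leaves
    the residue [1 - p] after a success and [- p] after a failure; weighted by [p] and [1 - p], the
    residues contribute one more [p * (1 - p)] times the mean increment of [phi]. *)
Lemma binexp_stein (R : comPzRingType) (p : R) m (phi : R -> R) :
  binexp p m.+1 (fun x => (x - m.+1%:R * p) * phi x) =
  m.+1%:R * p * (1 - p) * binexp p m (fun x => phi (x + 1) - phi x).
Proof.
elim: m phi => [|m IH] phi; first by rewrite /=; ring.
rewrite [LHS]/= -/(binexp p m.+1 _) -/(binexp p m.+1 _).
rewrite (@eq_binexp _ _ _ _ (fun x => (x - m.+1%:R * p) * phi (x + 1) +
  (1 - p) * phi (x + 1))); last by move=> x; rewrite -[m.+2]addn1 natrD; ring.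
rewrite (@eq_binexp _ _ _ (fun x => (x - m.+2%:R * p) * _)
    (fun x => (x - m.+1%:R * p) * phi x - p * phi x)); last first.
  by move=> x; rewrite -[m.+2]addn1 natrD; ring.
rewrite (binexpD _ _ (fun x => (x - _) * phi (x + 1))) binexpZ.
rewrite (binexpB _ _ (fun x => (x - _) * phi x)) binexpZ !IH.
rewrite (binexpB _ m.+1 (fun x => phi (x + 1))) /=
  (binexpB _ _ (fun x => phi (x + 1 + 1))) (binexpB _ _ (fun x => phi (x + 1))).
by rewrite -[m.+2]addn1 natrD; ring.
Qed.

Lemma ler_binexp (R : realDomainType) (p : R) m (phi psi : R -> R) :
  0 <= p <= 1 -> (forall x, phi x <= psi x) ->
  binexp p m phi <= binexp p m psi.
Proof.
move=> /andP[p0 p1]; elim: m phi psi => //= m IH phi psi le_phi_psi.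
by apply: lerD; apply: ler_wpM2l; rewrite ?subr_ge0//; exact: IH.
Qed.

Lemma ler_norm_binexp (R : realDomainType) (p : R) m (phi : R -> R) :
  0 <= p <= 1 -> `|binexp p m phi| <= binexp p m (fun x => `|phi x|).
Proof.
move=> p01; rewrite ler_norml -mulN1r -binexpZ; apply/andP.
split; apply: ler_binexp => // x.
  by rewrite mulN1r lerNl -normrN ler_norm.
exact: ler_norm.
Qed.

(** Only the case where the extra trial fails is kept. This moves a mean over [m] trials to [m.+1]
    trials, for which the variance is normalised. *)
Lemma binexp_le_succ (R : realDomainType) (p : R) m (phi : R -> R) :
  0 <= p <= 1 -> (forall x, 0 <= phi x) ->
  (1 - p) * binexp p m phi <= binexp p m.+1 phi.
Proof.
move=> p01 phi0 /=; rewrite lerDr mulr_ge0 ?(andP p01).1//.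
by rewrite -[leLHS](binexp_cst p _ m) ler_binexp.
Qed.

(** Stein's identity for the centred identity function, whose increments are 1. *)
Lemma binexp_variance (R : comPzRingType) (p : R) m :
  binexp p m.+1 (fun x => (x - m.+1%:R * p) ^+ 2) = m.+1%:R * p * (1 - p).
Proof.
rewrite (@eq_binexp _ _ _ _ (fun x => (x - m.+1%:R * p) * (x - m.+1%:R * p))).
  rewrite binexp_stein (@eq_binexp _ _ _ _ (fun=> 1)) ?binexp_cst ?mulr1// => x.
  by ring.
by move=> x; rewrite expr2.
Qed.

(** * Stein's bound for a normalised binomial variable *)

Section stein_bound.
Variables (R : realType) (p : R) (m : nat).
Hypotheses (p_gt0 : 0 < p) (p_lt1 : p < 1).
Let q := 1 - p.
Let s := Num.sqrt (m.+1%:R * p * q).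
Let W x := (x - m.+1%:R * p) / s.
Variables (h g dg : R -> R) (c w G G' : R).
Hypothesis g_derive : forall x : R, is_derive x 1 g (dg x).
Hypothesis dgE : forall x, dg x = x * g x + (h x - c).
Hypothesis g_bound : forall x, `|g x| <= G.
Hypothesis dg_bound : forall x, `|dg x| <= G'.
Hypothesis h_modulus : forall x y, `|x - y| <= s^-1 -> `|h x - h y| <= w.

Let q_gt0 : 0 < q. Proof. by rewrite subr_gt0. Qed.
Let p01 : 0 <= p <= 1. Proof. by rewrite !ltW. Qed.
Let var_gt0 : 0 < m.+1%:R * p * q. Proof. by rewrite !mulr_gt0. Qed.
Let s_gt0 : 0 < s. Proof. by rewrite sqrtr_gt0. Qed.
Let s2 : m.+1%:R * p * q = s ^+ 2. Proof. by rewrite sqr_sqrtr// ltW. Qed.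
Let WD1 x : W (x + 1) = W x + s^-1. Proof. by rewrite /W; field; exact: lt0r_neq0. Qed.

Let MVT_le (x y : R) : x <= y -> exists2 z, x <= z <= y & g y - g x = dg z * (y - x).
Proof.
move=> xy; have [|z] := @MVT_segment _ g dg x y xy (fun z _ => g_derive z).
  apply: derivable_within_continuous => z _.
  exact: (@ex_derive _ _ _ _ _ _ _ (g_derive z)).
by rewrite in_itv/= => ? ?; exists z.
Qed.

(** By the Stein equation the increment of [dg] is that of [h] plus
    [(y - x) * g y + x * (g y - g x)], where the mean value theorem handles the last difference. The
    factor [|x|] is replaced by [(1 + x ^+ 2) / 2] so that a second moment suffices when
    averaging. *)
Let dg_modulus x y : x <= y <= x + s^-1 ->
  `|dg y - dg x| <= w + s^-1 * (G + G' * ((1 + x ^+ 2) / 2)).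
Proof.
move=> /andP[xy yx].
have yx0 : 0 <= y - x <= s^-1 by rewrite subr_ge0 xy/= lerBlDl.
have [z _ gyx] := MVT_le xy.
have -> : dg y - dg x = (h y - h x) + ((y - x) * g y + x * (dg z * (y - x))).
  by rewrite -gyx !dgE; ring.
apply: (le_trans (ler_normD _ _)); apply: lerD.
  by apply: h_modulus; rewrite ger0_norm; case/andP: yx0.
have -> : (y - x) * g y + x * (dg z * (y - x)) = (y - x) * (g y + dg z * x).
  by ring.
rewrite normrM ger0_norm; last by case/andP: yx0.
apply: ler_pM => //; first by case/andP: yx0.
  by case/andP: yx0.
apply: (le_trans (ler_normD _ _)); apply: lerD => //.
rewrite normrM; apply: ler_pM => //.
have := sqr_ge0 (1 - `|x|); have := real_normK (num_real x); nra.
Qed.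

Lemma stein_binexp_bound :
  `|binexp p m.+1 (h \o W) - c| <= 2 * (w + s^-1 * (G + G' / q)).
Proof.
(* The mean of [dg (W x)] over [m.+1] trials is conditioned on one trial, while Stein's identity
   turns that of [W x * g (W x)] into [s] times an increment of [g]. Subtracting [dg (W x)] inside
   both parts leaves two differences that are small separately. *)
pose D x := p * (dg (W x + s^-1) - dg (W x)) -
            (s * (g (W x + s^-1) - g (W x)) - dg (W x)).
have -> : binexp p m.+1 (h \o W) - c = binexp p m D.
  rewrite -(binexp_cst p c m.+1) -binexpB.
  rewrite (@eq_binexp _ _ m.+1 _
    (fun x => dg (W x) - s^-1 * ((x - m.+1%:R * p) * g (W x)))); last first.
    by move=> x /=; rewrite dgE; move: (g _) (h _) => u v; rewrite /W; ring.
  rewrite (binexpB _ _ (fun x => dg (W x))) binexpZ binexp_stein -/q s2.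
  have -> X : s^-1 * (s ^+ 2 * X) = s * X by field; exact: lt0r_neq0.
  rewrite -binexpZ /=.
  rewrite -!binexpZ -binexpD -binexpB; apply: eq_binexp => x.
  by rewrite WD1 /D -/q /q; ring.
apply: (le_trans (ler_norm_binexp _ _ p01)).
pose B x := 2 * (w + s^-1 * (G + G' * ((1 + W x ^+ 2) / 2))).
apply: (@le_trans _ _ (binexp p m B)).
  apply: ler_binexp => // x.
  (* The mean value theorem makes [s] times the increment of [g] equal to [dg z], so both parts of
     [D] are increments of [dg] over at most [s^-1]. *)
  have [z /andP[xz zx]] : exists2 z, W x <= z <= W x + s^-1 &
      g (W x + s^-1) - g (W x) = dg z * (W x + s^-1 - W x).
    by apply: MVT_le; rewrite lerDl invr_ge0 (ltW s_gt0).
  rewrite /D => ->.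
  have -> : s * (dg z * (W x + s^-1 - W x)) = dg z.
    by field; exact: lt0r_neq0.
  apply: (le_trans (ler_normB _ _)); rewrite /B mulrDl mul1r; apply: lerD.
    rewrite normrM ger0_norm ?(ltW p_gt0)// -[leRHS]mul1r; apply: ler_pM => //.
    - exact: ltW.
    - exact: ltW.
    - by apply: dg_modulus; rewrite lexx lerDl invr_ge0 (ltW s_gt0).
  by apply: dg_modulus; rewrite xz zx.
have G'0 : 0 <= G' by apply: le_trans (dg_bound 0).
(* Over [m.+1] trials [W] has second moment 1, so the mean there is 1; the passage from [m] trials
   costs the factor [q^-1]. *)
have EW : binexp p m (fun x => (1 + W x ^+ 2) / 2) <= q^-1.
  rewrite -[leRHS]mulr1 ler_pdivlMl//.
  have W0 x : 0 <= (1 + W x ^+ 2) / 2 by rewrite divr_ge0// addr_ge0// sqr_ge0.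
  apply: (le_trans (binexp_le_succ _ p01 W0)).
  rewrite (@eq_binexp _ _ _ _ (fun x => 2^-1 + (2^-1 / s ^+ 2) * (x - m.+1%:R * p) ^+ 2)).
    rewrite binexpD binexp_cst binexpZ binexp_variance -/q s2 -mulrA mulVf ?mulr1.
      by lra.
    by rewrite expf_neq0// lt0r_neq0.
  by move=> x; rewrite /W; field; exact: lt0r_neq0.
rewrite /B binexpZ ler_wpM2l// binexpD binexp_cst lerD2l binexpZ.
rewrite ler_wpM2l ?invr_ge0 ?(ltW s_gt0)// binexpD binexp_cst lerD2l binexpZ.
exact: ler_wpM2l.
Qed.

End stein_bound.

(** * The standard Gaussian density and its tail *)

Section normal01.
Variable R : realType.
Local Notation mu := (@lebesgue_measure R).
Local Notation phi := (normal_pdf (0 : R) 1).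

Lemma normal_pdf01E x : phi x = normal_peak 1 * expR (- x ^+ 2 / 2).
Proof. by rewrite normal_pdfE ?oner_neq0// /normal_fun subr0 expr1n. Qed.

Lemma normal_pdf01_gt0 x : 0 < phi x.
Proof. by rewrite normal_pdf01E mulr_gt0 ?expR_gt0// normal_peak_gt0 ?oner_neq0. Qed.

Lemma normal_pdf01N x : phi (- x) = phi x.
Proof. by rewrite !normal_pdf01E sqrrN. Qed.

Lemma normal_pdf01_le x y : `|x| <= `|y| -> phi y <= phi x.
Proof.
move=> xy; rewrite !normal_pdf01E ler_wpM2l ?normal_peak_ge0// ler_expR.
by rewrite ler_pM2r ?invr_gt0// lerN2 -(real_normK (num_real x))
  -(real_normK (num_real y)) lerXn2r ?nnegrE.
Qed.

Lemma is_derive_normal_pdf01 (x : R) : is_derive x 1 phi (- x * phi x).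
Proof.
have -> : phi = fun x => normal_peak 1 * expR (- x ^+ 2 / 2) :> R.
  by apply/funext => y; rewrite normal_pdf01E.
apply: is_derive_eq.
by rewrite /GRing.scale/=; field.
Qed.

Lemma normal_pdf01_cvgy : phi x @[x --> +oo] --> (0 : R).
Proof.
have -> : phi = (fun y => normal_peak 1 * expR (- y)) \o (fun x => x ^+ 2 * 2^-1).
  by apply/funext => y; rewrite normal_pdf01E /= mulNr.
have sqr2y : (x ^+ 2 * 2^-1 : R) @[x --> +oo] --> +oo.
  by apply: gt0_cvgMly; [rewrite invr_gt0|exact: cvgr_expr2].
have expRNy : (normal_peak 1 * expR (- x) : R) @[x --> +oo] --> 0.
  by rewrite -[X in _ --> X](mulr0 (normal_peak 1)); apply: cvgM;
    [exact: cvg_cst|exact: cvgr_expR].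
exact: (cvg_comp _ _ sqr2y expRNy).
Qed.

(** The Radon-Nikodym derivative agrees almost everywhere with the density, since both have the same
    integral over every measurable set. *)
Lemma integral_normal_prob (m s : R) (f : R -> R) : s != 0 ->
  (normal_prob m s).-integrable [set: measurableTypeR R] (EFin \o f) ->
  \int[normal_prob m s]_x f x = \int[mu]_x (f x * normal_pdf m s x).
Proof.
move=> s0 intf.
rewrite /Rintegral; congr fine.
rewrite -(Radon_Nikodym_change_of_variables (normal_prob_dominates m s))//=.
apply: ae_eq_integral => //.
- apply: emeasurable_funM => //; first exact: measurable_int intf.
  apply: (measurable_int mu).
  by apply: Radon_Nikodym_integrable; exact: normal_prob_dominates.
- apply/measurable_EFinP; apply: measurable_funM; last exact: measurable_normal_pdf.
  by move: (measurable_int _ intf) => /measurable_EFinP.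
under [X in ae_eq _ _ _ X]eq_fun do rewrite EFinM.
apply: ae_eqe_mul2l => /=.
rewrite Radon_NikodymE//=; first exact: normal_prob_dominates.
move=> abmu.
case: cid => /= h [h1 h2 h3].
apply: integral_ae_eq => //=.
- by apply/measurable_EFinP; exact: measurable_normal_pdf.
- by move=> E _ mE; rewrite -h3.
Qed.

(** On the domain of integration [phi x] is at most [x * phi x / a], and [x * phi x] has the
    primitive [- phi], which vanishes at infinity. *)
Lemma mills_normal_pdf01 (a : R) : 0 < a ->
  (\int[mu]_(x in `[a, +oo[) (phi x)%:E <= (phi a / a)%:E)%E.
Proof.
move=> a0.
have cphi := @continuous_normal_pdf R 0 1 (oner_neq0 R).
have : (\int[mu]_(x in `[a, +oo[) (x * phi x)%:E = 0%:E - (- phi a)%:E)%E.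
  apply: (@ge0_continuous_FTC2y _ (fun x => x * phi x) (fun x => - phi x)).
  - by move=> x ax; rewrite mulr_ge0 ?normal_pdf_ge0// (le_trans _ ax)// ltW.
  - apply: continuous_subspaceT => x; apply: cvgM; [exact: cvg_id|exact: cphi].
  - by have := cvgN normal_pdf01_cvgy; rewrite oppr0; exact.
  - by move=> x _; apply: derivableN;
       exact: (@ex_derive _ _ _ _ _ _ _ (is_derive_normal_pdf01 x)).
  - by apply: cvgN; apply: cvg_at_right_filter; exact: cphi.
  - move=> x _; rewrite derive1E
      (@derive_val _ _ _ _ _ _ _ (is_deriveN (is_derive_normal_pdf01 x))).
    by rewrite mulNr opprK.
rewrite sub0e EFinN oppeK => phiE.
have mphi : measurable_fun (`[a, +oo[ : set R) phi.
  by apply/measurable_funTS; exact: measurable_normal_pdf.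
have mxphi : measurable_fun (`[a, +oo[ : set R) (fun x => x * phi x).
  exact: measurable_funM.
have xphi0 x : `[a, +oo[%classic x -> 0 <= x * phi x.
  rewrite /= in_itv/= andbT => ax.
  by rewrite mulr_ge0 ?normal_pdf_ge0// (le_trans (ltW a0)).
rewrite EFinM muleC -phiE -ge0_integralZl//=; last 2 first.
- exact/measurable_EFinP.
- by rewrite lee_fin invr_ge0 ltW.
apply: ge0_le_integral => //=.
- by move=> x _; rewrite lee_fin normal_pdf_ge0.
- exact/measurable_EFinP.
- by apply/measurable_EFinP; apply: measurable_funM.
- move=> x; rewrite in_itv/= andbT => ax; rewrite -EFinM lee_fin mulrA.
  by rewrite ler_peMl ?normal_pdf_ge0// ler_pdivlMl// mulr1.
Qed.

End normal01.

(** * The bounded solution of the Stein equation *)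

Section stein_solution.
Variable R : realType.
Local Notation mu := (@lebesgue_measure R).
Local Notation phi := (normal_pdf (0 : R) 1).
Variables (h : R -> R) (B c : R).
Hypothesis h_continuous : continuous h.
Hypothesis h_bound : forall x, `|h x - c| <= B.
Hypothesis h_integrable :
  (normal_prob 0 1).-integrable [set: measurableTypeR R] (EFin \o h).
Hypothesis h_mean : \int[normal_prob 0 1]_x h x = c.

Let k x := (h x - c) * phi x.

Let k_continuous : continuous k.
Proof.
move=> x; apply: cvgM; last exact: (@continuous_normal_pdf R 0 1 (oner_neq0 R)).
by apply: cvgB; [exact: h_continuous|exact: cvg_cst].
Qed.

Let B_ge0 : 0 <= B. Proof. exact: le_trans (h_bound 0). Qed.

Let k_le x : `|k x| <= B * phi x.
Proof.
by rewrite normrM (ger0_norm (normal_pdf_ge0 _ _ _)) ler_wpM2r ?normal_pdf_ge0.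
Qed.

Let k_integrable : mu.-integrable setT (EFin \o k).
Proof.
have Bphi := integrableZl measurableT B (@integrable_normal_pdf R 0 1).
apply: (le_integrable measurableT _ _ Bphi).
- by apply/measurable_EFinP; exact: continuous_measurable_fun.
- move=> x _ /=; rewrite lee_fin; apply: le_trans (k_le x) _; exact: ler_norm.
Qed.

Let k_integrableS (A : set (measurableTypeR R)) :
  measurable A -> mu.-integrable A (EFin \o k).
Proof. by move=> mA; exact: integrableS k_integrable. Qed.

(** Centring by the Gaussian mean is what allows the primitive of [k] to be computed from either end
    of the line. *)
Let k_integral0 : \int[mu]_x k x = 0.
Proof.
have intc : (normal_prob 0 1).-integrable [set: measurableTypeR R] (EFin \o cst c).
  exact: finite_measure_integrable_cst.
rewrite /k -(@integral_normal_prob _ 0 1 (fun x => h x - c)) ?oner_neq0//.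
  rewrite RintegralB// h_mean Rintegral_cst// [fine _](_ : _ = 1) ?mulr1 ?subrr//.
  by rewrite /= /normal_prob integral_normal_pdf.
exact: (integrableB measurableT h_integrable intc).
Qed.

Let norm_k_integral (A : set (measurableTypeR R)) (b : R) : measurable A ->
  (\int[mu]_(x in A) (phi x)%:E <= b%:E)%E -> `|\int[mu]_(x in A) k x| <= B * b.
Proof.
move=> mA phib.
have intphi : mu.-integrable A (EFin \o phi).
  by apply: integrableS (integrable_normal_pdf 0 1).
apply: (le_trans (le_normr_Rintegral mA (k_integrableS mA))).
apply: (@le_trans _ _ (\int[mu]_(x in A) (B * phi x))).
  apply: le_Rintegral => //.
  - by have := integrable_norm (k_integrableS mA).
  - exact: (integrableZl mA B intphi).
rewrite RintegralZl// ler_wpM2l// -lee_fin fineK//.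
exact: integrable_fin_num.
Qed.

Definition stein_primitive (x : R) : R := \int[mu]_(t in `]-oo, x]) k t.
Local Notation F := stein_primitive.

Lemma is_derive_stein_primitive (x : R) : is_derive x 1 F (k x).
Proof.
have kx : {for x, continuous k} by exact: k_continuous.
(* Any right end point beyond [x] would do in place of [x + 1]. *)
have [] := @continuous_FTC1 R k -oo%O x (x + 1) _ _ _ kx.
- by rewrite ltrDl.
- exact: k_integrableS.
- by rewrite ltNyr.
by move=> dF F'; apply: DeriveDef => //; rewrite -derive1E.
Qed.

Lemma stein_primitive_le x : `|F x| <= B.
Proof.
rewrite -[leRHS]mulr1; apply: norm_k_integral => //.
rewrite -(integral_normal_pdf 0 1); apply: ge0_subset_integral => //.
- by apply/measurable_EFinP; exact: measurable_normal_pdf.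
- by move=> y _; rewrite lee_fin normal_pdf_ge0.
Qed.

(** For [x < 0] the integral defining [F] is a left tail, reflected onto the right tail from [- x].
    For [x > 0] it is minus the right tail, the total integral being 0. Mills' bound applies to
    both. *)
Lemma stein_primitive_tail x : `|x| * `|F x| <= B * phi x.
Proof.
have [->|x0] := eqVneq x 0; first by rewrite normr0 mul0r mulr_ge0// normal_pdf_ge0.
rewrite mulrC -ler_pdivlMr ?normr_gt0// -mulrA.
have mphi (A : set (measurableTypeR R)) : measurable A -> measurable_fun A phi.
  by move=> mA; apply/measurable_funTS; exact: measurable_normal_pdf.
move: x0; rewrite neq_lt => /orP[x0|x0].
  apply: norm_k_integral => //; rewrite (ltr0_norm x0) -normal_pdf01N.
  have := mills_normal_pdf01 (a := - x); rewrite oppr_gt0 => /(_ x0).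
  apply: le_trans; rewrite -[x in `]-oo, x]]opprK ge0_integration_by_substitutionNy.
  - rewrite le_eqVlt; apply/orP; left; apply/eqP; apply: eq_integral => y _ /=.
    by rewrite normal_pdf01N.
  - by apply: continuous_subspaceT; exact: (@continuous_normal_pdf R 0 1 (oner_neq0 R)).
  - by move=> y _; exact: normal_pdf_ge0.
have -> : F x = - \int[mu]_(t in `]x, +oo[) k t.
  apply/eqP; rewrite -addr_eq0 -Rintegral_setU//=.
  - by rewrite -k_integral0; apply/eqP; congr (\int[mu]_(t in _) k t);
       rewrite -setCitvl setUv.
  - by apply: k_integrableS; exact: measurableU.
  - by rewrite -setCitvl; apply/disj_set2P; rewrite setICr.
rewrite normrN (gtr0_norm x0); apply: norm_k_integral => //.
apply: le_trans (mills_normal_pdf01 x0).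
apply: ge0_subset_integral => //.
- by apply/measurable_EFinP; exact: mphi.
- by move=> y _; rewrite lee_fin normal_pdf_ge0.
- by apply: subset_itvr; rewrite bnd_simp.
Qed.

(** Variation of constants: [1 / phi] solves the homogeneous equation g' = x g. *)
Definition stein_solution (x : R) : R := F x / phi x.
Local Notation g := stein_solution.

Lemma is_derive_stein_solution (x : R) : is_derive x 1 g (x * g x + (h x - c)).
Proof.
have phi0 := normal_pdf01_gt0 x.
apply: (is_derive_eq (is_deriveM (is_derive_stein_primitive x)
  (is_deriveV (lt0r_neq0 phi0) (is_derive_normal_pdf01 x)))).
rewrite /GRing.scale/= /g /k.
by field; exact: lt0r_neq0.
Qed.

Lemma stein_solution_mul_le x : `|x * g x| <= B.
Proof.
have phi0 := normal_pdf01_gt0 x.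
by rewrite mulrA normrM normfV normrM (gtr0_norm phi0) ler_pdivrMr// stein_primitive_tail.
Qed.

(** For [|x| <= 1] the denominator is at least [phi 1]; beyond, [|g x|] is at most [|x * g x|]. The
    constant is the sum of the two bounds. *)
Lemma stein_solution_le x : `|g x| <= B * (1 + (phi 1)^-1).
Proof.
have phi0 := normal_pdf01_gt0 x.
have [x1|x1] := leP `|x| 1.
  rewrite mulrDr mulr1 -[leLHS]add0r lerD// normrM normfV (gtr0_norm phi0).
  apply: ler_pM => //; [by rewrite invr_ge0 ltW|exact: stein_primitive_le|].
  by rewrite lef_pV2 ?posrE ?normal_pdf01_gt0// normal_pdf01_le// normr1.
apply: (@le_trans _ _ B).
  apply: le_trans (stein_solution_mul_le x).
  by rewrite (normrM x) ler_peMl// ltW.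
by rewrite ler_peMr// lerDl invr_ge0 normal_pdf_ge0.
Qed.

End stein_solution.

Lemma stein_normal_bound (R : realType) (p : R) (m : nat) (h : R -> R) (B c w : R) :
  0 < p < 1 -> continuous h ->
  (normal_prob 0 1).-integrable [set: measurableTypeR R] (EFin \o h) ->
  \int[normal_prob 0 1]_x h x = c -> (forall x, `|h x - c| <= B) ->
  let s := Num.sqrt (m.+1%:R * p * (1 - p)) in
  (forall x y, `|x - y| <= s^-1 -> `|h x - h y| <= w) ->
  `|binexp p m.+1 (fun x => h ((x - m.+1%:R * p) / s)) - c| <=
  2 * (w + s^-1 * (B * (1 + (normal_pdf 0 1 1)^-1 + 2 / (1 - p)))).
Proof.
move=> /andP[p0 p1] ch ih hc hB s hw.
(* [B + B] bounds the derivative: one [B] for [x * g x] and one for [h x - c]. *)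
have -> : B * (1 + (normal_pdf 0 1 1)^-1 + 2 / (1 - p)) =
  B * (1 + (normal_pdf 0 1 1)^-1) + (B + B) / (1 - p) by ring.
apply: (@stein_binexp_bound R p m p0 p1 h (stein_solution h c)
  (fun x => x * stein_solution h c x + (h x - c))) => //.
    by move=> x; exact: (is_derive_stein_solution ch hB).
  exact: stein_solution_le ch hB ih hc.
move=> x; apply: (le_trans (ler_normD _ _)); apply: lerD => //.
exact: stein_solution_mul_le ch hB ih hc x.
Qed.

Lemma finite_measure_bounded_integrable d (T : measurableType d) (R : realType)
    (mu : {finite_measure set T -> \bar R}) (D : set T) (f : T -> R) (M : R) :
  measurable D -> measurable_fun D f -> (forall x, `|f x| <= M) ->
  mu.-integrable D (EFin \o f).
Proof.
move=> mD mf fM.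
apply: (le_integrable mD _ _ (finite_measure_integrable_cst mu M mD)).
  exact/measurable_EFinP.
by move=> x _ /=; rewrite lee_fin (le_trans (fM x))// ler_norm.
Qed.

(** * The law of a sum of independent Bernoulli variables *)

Section bernoulli_sum.
Context d (T : measurableType d) (R : realType) (P : probability T R).
Variables (p : R) (X : nat -> {RV P >-> R}).
Hypothesis X_independent : independent_RVs X.
Hypothesis X_01 : forall n w, X n w = 0 \/ X n w = 1.
Hypothesis X_eq1 : forall n, P (X n @^-1` [set 1]) = p%:E.
Hypothesis X_eq0 : forall n, P (X n @^-1` [set 0]) = (1 - p)%:E.

Let event s (B : nat -> set R) := \big[setI/setT]_(i <- s) (X i @^-1` B i).

Let mX n (B : set R) : measurable B -> measurable (X n @^-1` B).
Proof. by move=> mB; rewrite -[X in measurable X]setTI; exact: measurable_funP. Qed.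

Let measurable_event s B : (forall i, measurable (B i)) -> measurable (event s B).
Proof.
move=> mB; rewrite /event; elim: s => [|i s IH]; first by rewrite big_nil.
by rewrite big_cons; apply: measurableI => //; exact: mX.
Qed.

Let upd m (b : R) (B : nat -> set R) i := if i == m then [set b] else B i.

Let eventU m b s B : m \notin s ->
  event (m :: s) (upd m b B) = X m @^-1` [set b] `&` event s B.
Proof.
move=> ms; rewrite /event big_cons {1}/upd eqxx; congr (_ `&` _).
apply: eq_big_seq => i si; rewrite /upd; case: eqP => // im.
by rewrite im (negbTE ms) in si.
Qed.

Let P_eventU m b s B (r : R) : uniq (m :: s) -> (forall i, measurable (B i)) ->
  P (X m @^-1` [set b]) = r%:E ->
  P (event (m :: s) (upd m b B)) = (r%:E * P (event s B))%E.
Proof.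
move=> ums mB Pr; have /andP[ms us] := ums.
have mU i : measurable (upd m b B i) by rewrite /upd; case: eqP.
rewrite /event (X_independent ums mU) (X_independent us mB) big_cons.
rewrite {1}/upd eqxx Pr; congr (_ * _)%E.
apply: eq_big_seq => i si; rewrite /upd; case: eqP => // im.
by rewrite im (negbTE ms) in si.
Qed.

(** Integrating over events on indices at least [m] makes the induction go through: the event is
    split by the value of [X m], which is independent of it, and on each piece the last summand is
    constant and shifts [phi]. *)
Lemma integral_bernoulli_sum m (phi : R -> R) (M : R) s (B : nat -> set R) :
  measurable_fun setT phi -> (forall x, `|phi x| <= M) ->
  uniq s -> (forall i, i \in s -> (m <= i)%N) -> (forall i, measurable (B i)) ->
  \int[P]_(w in event s B) phi (\sum_(i < m) X i w) =
  fine (P (event s B)) * binexp p m phi.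
Proof.
elim: m phi s B => [|m IH] phi s B mphi phiM us ms mB.
  rewrite (@eq_Rintegral _ _ _ _ _ (cst (phi 0))); last by move=> w _; rewrite big_ord0.
  rewrite Rintegral_cst; last exact: measurable_event.
  exact: mulrC.
have mNs : m \notin s by apply/negP => /ms; rewrite ltnn.
have ums : uniq (m :: s) by rewrite /= mNs.
have mms i : i \in m :: s -> (m <= i)%N.
  by rewrite inE => /orP[/eqP->//|/ms/ltnW].
have mU b i : measurable (upd m b B i) by rewrite /upd; case: eqP.
have -> : event s B = event (m :: s) (upd m 1 B) `|` event (m :: s) (upd m 0 B).
  rewrite !eventU// -setIUl; apply/seteqP; split => [w Aw|w []//]; split => //.
  by case: (X_01 m w) => ?; [right|left].
have mS n : measurable_fun setT (fun w => \sum_(i < n) X i w).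
  exact: measurable_sum.
have mphiS n : measurable_fun setT (fun w => phi (\sum_(i < n) X i w)).
  exact: (measurableT_comp mphi (mS n)).
have m1 := measurable_event (m :: s) (mU 1).
have m0 := measurable_event (m :: s) (mU 0).
have disj : [disjoint event (m :: s) (upd m 1 B) & event (m :: s) (upd m 0 B)].
  apply/disj_set2P; rewrite !eventU//; apply/seteqP; split => // w [[w1 _] [w0 _]].
  by have /eqP := oner_neq0 R; rewrite -w1 -w0.
rewrite Rintegral_setU//; last first.
  apply: (@finite_measure_bounded_integrable _ _ _ _ _ _ M) => //.
    exact: measurableU.
  exact: measurable_funTS.
rewrite measureU//; last exact/disj_set2P.
rewrite fineD ?fin_num_measure// mulrDl /=.
have Pb b (r : R) : P (X m @^-1` [set b]) = r%:E ->
    fine (P (event (m :: s) (upd m b B))) = r * fine (P (event s B)).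
  by move=> /(P_eventU ums mB) ->; rewrite fineM ?fin_num_measure//;
     exact: measurable_event.
have int_b b : \int[P]_(w in event (m :: s) (upd m b B)) phi (\sum_(i < m.+1) X i w) =
    fine (P (event (m :: s) (upd m b B))) * binexp p m (fun x => phi (x + b)).
  rewrite -IH//.
  - apply: eq_Rintegral => w; rewrite inE eventU// => -[Xb _].
    by rewrite big_ord_recr/= Xb.
  - by apply: (measurableT_comp mphi); exact: measurable_funD.
rewrite !int_b (Pb _ _ (X_eq1 m)) (Pb _ _ (X_eq0 m)).
rewrite (@eq_binexp _ _ _ (fun x => phi (x + 0)) phi); last by move=> x; rewrite addr0.
by ring.
Qed.

End bernoulli_sum.

(** * Global modulus and bound from compact support *)

Section compact_support_modulus.
Variables (R : realType) (f : R -> R) (L : nat).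
Hypothesis f_support : forall x, L%:R <= `|x| -> f x = 0.

(** If one point lies beyond radius [L.+1], the other is less than 1 away, hence beyond [L], and
    both values vanish. *)
Lemma compact_support_modulus (a k : nat) :
  (forall x y, `|x| <= L.+1%:R -> `|y| <= L.+1%:R -> `|x - y| < 2 ^- a ->
     `|f x - f y| < 2 ^- k) ->
  forall x y, `|x - y| < 2 ^- a -> `|f x - f y| < 2 ^- k.
Proof.
move=> fa x y xya.
have xy1 : `|x - y| < 1.
  by rewrite (lt_le_trans xya)// invf_le1 ?exprn_gt0// exprn_ege1// ler1n.
have far u v : `|u - v| < 1 -> L.+1%:R < `|u| -> f u - f v = 0.
  move=> uv Lu; rewrite !f_support ?subrr//.
    by rewrite -(lerD2r 1) natr1 (le_trans (ltW Lu))// -{1}(subrK v u)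
      (le_trans (ler_normD _ _))// addrC lerD2l ltW.
  by rewrite (le_trans _ (ltW Lu))// ler_nat.
have [xL|xL] := leP `|x| L.+1%:R; last first.
  by rewrite (far x y)// normr0 invr_gt0 exprn_gt0.
have [yL|yL] := leP `|y| L.+1%:R; first exact: fa.
by rewrite distrC (far y x) 1?distrC// normr0 invr_gt0 exprn_gt0.
Qed.

(** Walking outwards from [x] in steps of [2 ^- a.+1], each changing [f] by less than 1, leaves the
    support after at most [L * 2 ^ a.+1] steps. The bound is rounded up to a power of two so that
    the final rate involves only sums of exponents. *)
Lemma compact_support_bound (a : nat) :
  (forall x y, `|x - y| < 2 ^- a -> `|f x - f y| < 1) ->
  forall x, `|f x| <= 2 ^+ (L + a.+1).
Proof.
move=> fa x.
have d0 : 0 < 2 ^- a.+1 :> R by rewrite invr_gt0 exprn_gt0.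
have da : 2 ^- a.+1 < 2 ^- a :> R.
  by rewrite ltf_pV2 ?posrE ?exprn_gt0// ltr_eXn2l// ltr1n.
have step j : forall y, L%:R - `|y| <= j%:R * 2 ^- a.+1 -> `|f y| <= j%:R.
  elim: j => [|j IH] y; first by rewrite mul0r subr_le0 => /f_support ->; rewrite normr0.
  have [Ly _|yL] := leP L%:R `|y|; first by rewrite f_support// normr0.
  (* One step away from the origin, so that [|z|] is exactly [|y|] plus the step. *)
  pose z := if 0 <= y then y + 2 ^- a.+1 else y - 2 ^- a.+1.
  have yz : `|y - z| < 2 ^- a.
    by rewrite /z; case: ifP => _; rewrite ?opprD ?opprB ?addrA ?addrK
      ?subrr ?add0r ?normrN ?addrCA ?subrr ?addr0 gtr0_norm.
  have nz : `|z| = `|y| + 2 ^- a.+1.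
    rewrite /z; case: ifPn => [y0|]; first by rewrite !ger0_norm// addr_ge0// ltW.
    rewrite -ltNge => y0; rewrite !ltr0_norm//; first by rewrite opprB addrC.
    by rewrite subr_lt0 (lt_trans y0).
  move=> yj; rewrite -(subrK (f z) (f y)) (le_trans (ler_normD _ _))//.
  rewrite -natr1 addrC lerD ?(ltW (fa _ _ yz))// IH// nz.
  by move: yj; rewrite -natr1 mulrDl mul1r; lra.
apply: (@le_trans _ _ (L * 2 ^ a.+1)%:R); last first.
  by rewrite exprD -!natrX -natrM ler_nat leq_mul2r ltnW ?orbT// ltn_expl.
by apply: step; rewrite natrM natrX mulfK ?expf_neq0// lerBlDr lerDl.
Qed.

Lemma modulus_continuous (alpha : nat -> nat) :
  (forall k x y, `|x - y| < 2 ^- alpha k -> `|f x - f y| < 2 ^- k) ->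
  continuous f.
Proof.
move=> fa x; apply/cvgrPdist_lt => e e0.
have [k ke] : exists k : nat, 2 ^- k < e.
  exists (Num.truncn e^-1).+1.
  rewrite -[ltRHS]invrK ltf_pV2 ?posrE ?exprn_gt0 ?invr_gt0//.
  by rewrite (lt_le_trans (truncnS_gt _))// -natrX ler_nat ltnW// ltn_expl.
near=> y; apply: lt_trans ke; apply: fa.
near: y; apply: (@cvgr_dist_lt _ R^o _ (nbhs x) _ id x).
Unshelve. all: by end_near. Qed.

End compact_support_modulus.

(** * The recursive rate of convergence *)

Theorem theorem5p1 (R : realType) (d : measure_display) (T : measurableType d)
    (P : probability T R) (p q : R) (X : nat -> {RV P >-> R})
    (Y : nat -> {RV P >-> measurableTypeR R})
    (p_computable : computable_real p) (p_gt0 : 0 < p) (p_lt1 : p < 1)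
    (q_def : q = 1 - p)
    (X_independent : independent_RVs X)
    (X_01 : forall (n : nat) (w : T), X n w = 0 \/ X n w = 1)
    (X_eq1 : forall n : nat, P [set w | X n w = 1] = p%:E)
    (X_eq0 : forall n : nat, P [set w | X n w = 0] = q%:E)
    (Y_def : forall m : nat, (0 < m)%N -> forall w : T,
       Y m w = (\sum_(i < m) X i w - m%:R * p) / Num.sqrt (m%:R * p * q) :> R) :
  converges_effectively (fun m => distribution P (Y m)) (normal_prob 0 1).
Proof.
subst q.
have p01 : 0 < p < 1 by rewrite p_gt0.
have pq0 : 0 < Num.sqrt (p * (1 - p)) by rewrite sqrtr_gt0 mulr_gt0// subr_gt0.
move=> f [[_ [alpha [ralpha falpha]]] [L [rL fL]]].
pose K := 1 + (normal_pdf (0 : R) 1 1)^-1 + 2 / (1 - p).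
have K1 : 1 <= K.
  by rewrite /K -addrA lerDl addr_ge0// ?invr_ge0 ?normal_pdf_ge0//
    divr_ge0// subr_ge0 ltW.
have K0 : 0 < K by exact: lt_le_trans K1.
(* [K] is the factor of [B] in [stein_normal_bound]; the exponent [C] absorbs it together with the
   standard deviation of one trial. *)
pose C := (Num.truncn (8 * K / Num.sqrt (p * (1 - p)))).+1.
have CK : 8 * K < 2 ^+ C * Num.sqrt (p * (1 - p)).
  rewrite -ltr_pdivrMr// (lt_le_trans (truncnS_gt _))// -natrX ler_nat ltnW//.
  exact: ltn_expl.
pose a n k := alpha n (L n).+1 k.
(* The first summand brings the step [s^-1] within the modulus of [f n] for precision [k.+2]; the
   others dominate the bound on [f n] times [2 ^+ k.+1]. *)
pose N n k := (a n k.+2 + (a n 0 + (L n + k.+1)))%N.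
(* The exponent is doubled because [s] grows only like the square root of [m]. *)
exists (fun n k => 2 ^ ((N n k + C) + (N n k + C)))%N; split.
  have v0 : recursive (fun v : 2.-tuple nat => nth 0%N v 0).
    exact: (@recursive_tnth _ _ ord0).
  have v1 : recursive (fun v : 2.-tuple nat => nth 0%N v 1).
    exact: (@recursive_tnth _ _ (@Ordinal 2 1 isT)).
  have rS := recursive1_S.
  have rLv := recursive_comp1 rL v0.
  have ra g : recursive g ->
      recursive (fun v : 2.-tuple nat => a (nth 0%N v 0) (g v)).
    by apply: (recursive_comp3 ralpha v0); exact: (recursive_comp1 rS rLv).
  have rN : recursive (fun v : 2.-tuple nat => N (nth 0%N v 0) (nth 0%N v 1) + C)%N.
    apply: (recursive_comp2 recursive2_addn); last exact: recursive_const.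
    apply: (recursive_comp2 recursive2_addn).
      by apply: ra; do 2 apply: (recursive_comp1 rS).
    apply: (recursive_comp2 recursive2_addn); first exact/ra/recursive_const.
    by apply: (recursive_comp2 recursive2_addn) => //; exact: recursive_comp1.
  apply: (recursive_comp1 recursive1_exp2n).
  exact: (recursive_comp2 recursive2_addn).
move=> n k m Nm.
have fmod j := compact_support_modulus (fL n)
  (fun x y hx hy => falpha n (L n).+1 j x y hx hy).
have f_cont : continuous (f n) := modulus_continuous fmod.
have fmod0 x y : `|x - y| < 2 ^- a n 0%N -> `|f n x - f n y| < 1.
  by move=> /fmod; rewrite expr0 invr1.
have fM := compact_support_bound (fL n) fmod0.
set M := 2 ^+ _ in fM.
have mf : measurable_fun setT (f n) by exact: continuous_measurable_fun.
have fint : (normal_prob 0 1).-integrable [set: measurableTypeR R] (EFin \o f n).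
  exact: (@finite_measure_bounded_integrable _ _ _ (normal_prob 0 1) setT (f n) M).
set c := \int[normal_prob 0 1]_x f n x.
have cM : `|c| <= M.
  apply: (le_trans (le_normr_Rintegral _ fint)) => //.
  apply: (@le_trans _ _ (\int[normal_prob 0 1]_(x in [set: measurableTypeR R]) cst M x)).
    apply: le_Rintegral => //.
    - exact: (integrable_norm fint).
    - exact: finite_measure_integrable_cst.
  by rewrite Rintegral_cst// /= /normal_prob integral_normal_pdf mulr1.
(* The rate is a positive number, which excludes [m = 0], where [Y_def] says nothing. *)
have m0 : (0 < m)%N by rewrite (leq_trans _ Nm)// expn_gt0.
case: m m0 Nm => // m _ Nm.
pose s := Num.sqrt (m.+1%:R * p * (1 - p)).
have sN : 2 ^+ N n k * (8 * K) < s.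
  rewrite /s -mulrA sqrtrM//.
  apply: (@lt_le_trans _ _ (2 ^+ (N n k + C) * Num.sqrt (p * (1 - p)))).
    by rewrite exprD -mulrA ltr_pM2l ?exprn_gt0.
  rewrite ler_pM2r// -[leLHS]ger0_norm ?exprn_ge0// -sqrtr_sqr ler_sqrt//.
  by rewrite -exprM muln2 -addnn -natrX ler_nat.
have s0 : 0 < s by apply: lt_trans sN; rewrite mulr_gt0 ?exprn_gt0// mulr_gt0.
have -> : \int[distribution P (Y m.+1)]_x f n x =
    binexp p m.+1 (fun x => f n ((x - m.+1%:R * p) / s)).
  have mphi : measurable_fun setT (fun x : R => f n ((x - m.+1%:R * p) / s)).
    apply: (measurableT_comp mf); apply: measurable_funM => //.
    exact: measurable_funB.
  (* The empty list of conditions gives the integral over the whole space. *)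
  have := integral_bernoulli_sum X_independent X_01 X_eq1 X_eq0 (m := m.+1)
    (s := [::]) (B := fun=> setT) mphi (fun x => fM _) isT.
  rewrite big_nil probability_setT mul1r => <- //.
  rewrite /Rintegral integral_distribution/=.
  - by congr fine; apply: eq_integral => w _ /=; rewrite Y_def.
  - exact/measurable_EFinP.
  - apply: (@finite_measure_bounded_integrable _ _ _ _ _ (f n \o Y m.+1) M) => //;
      last by move=> w; exact: fM.
    have mf' : measurable_fun [set: measurableTypeR R] (f n) := mf.
    exact: (measurableT_comp mf').
have fcM x : `|f n x - c| <= M + M.
  by rewrite (le_trans (ler_normB _ _))// lerD.
(* Precision [2 ^- k.+2] makes the term [2 * w] of Stein's bound one half of the tolerance. *)
have smod x y : `|x - y| <= s^-1 -> `|f n x - f n y| <= 2 ^- k.+2.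
  move=> xys; apply/ltW/fmod; apply: (le_lt_trans xys).
  rewrite ltf_pV2 ?posrE ?exprn_gt0//; apply: le_lt_trans sN.
  apply: (@le_trans _ _ (2 ^+ N n k)).
    by apply: ler_weXn2l; [rewrite ler1n|exact: leq_addr].
  by rewrite ler_peMr ?exprn_ge0//; lra.
apply: (le_lt_trans (stein_normal_bound p01 f_cont fint erefl fcM smod)).
rewrite -/K mulrDr.
have -> : 2 * 2 ^- k.+2 = 2 ^- k.+1 :> R.
  by rewrite [in LHS]exprS invfM mulrA divff ?mul1r.
have -> : 2 ^- k = 2 ^- k.+1 + 2 ^- k.+1 :> R.
  by rewrite exprS invfM -mulr2n -[RHS]mulr_natl mulrA divff ?mul1r.
rewrite ltrD2l.
have u0 : 0 < 2 ^+ k.+1 :> R by rewrite exprn_gt0.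
(* The other half: with [B = M + M] the remaining term is [4 * K * M / s], and this inequality
   together with the 8 in [sN] puts it below [2 ^- k.+1]. *)
have MN : M * 2 ^+ k.+1 <= 2 * 2 ^+ N n k.
  rewrite -exprD -exprS; apply: ler_weXn2l; first by rewrite ler1n.
  by rewrite /N; lia.
rewrite -[ltRHS]mul1r ltr_pdivlMr//.
have -> : 2 * (s^-1 * ((M + M) * K)) * 2 ^+ k.+1 = (4 * K * (M * 2 ^+ k.+1)) / s.
  by move: (2 ^+ k.+1) => u; ring.
rewrite ltr_pdivrMr// mul1r; apply: le_lt_trans sN.
have -> : 2 ^+ N n k * (8 * K) = 4 * K * (2 * 2 ^+ N n k) by ring.
by rewrite ler_wpM2l// mulr_ge0// ltW.
Qed.
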